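(* Consider the parallel multiple access channel power allocation game with $K$ users and $A$ nodes, as described in the context, with random channel gains. Then, almost surely, the game has a unique Nash equilibrium.
   Context: Setting: users $\mathcal{K}=\{1,\dots,K\}$, nodes $\mathcal{A}=\{1,\dots,A\}$. User $k$ has maximum power $P_k>0$ and strategy set $\Delta_k=\{p_k\in\mathbb{R}^{\mathcal{A}}: p_{k\alpha}\ge 0,\ \sum_\alpha p_{k\alpha}=P_k\}$; $\Delta=\prod_k\Delta_k$. The payoff of user $k$ at profile $p=(p_1,\dots,p_K)\in\Delta$ is $u_k(p)=\sum_{\alpha\in\mathcal{A}} b_\alpha\log\bigl(1+\frac{g_{k\alpha}p_{k\alpha}}{\sigma_\alpha^2+\sum_{\ell\neq k}g_{\ell\alpha}p_{\ell\alpha}}\bigr)$, where $b_\alpha>0$ and $\sigma_\alpha^2>0$ are constants and the channel gains $g_{k\alpha}>0$ are random, drawn from a continuous (nonatomic) probability distribution on the positive reals; ''almost surely'' refers to their law. $q\in\Delta$ is a Nash equilibrium if $u_k(q)\ge u_k(q_{-k};q_k')$ for every user $k$ and every $q_k'\in\Delta_k$. *)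

(* Defs.v *)
From HB Require Import structures.
From mathcomp Require Import all_boot all_order all_algebra.
From mathcomp Require Import all_classical all_reals all_analysis.
Set Implicit Arguments. Unset Strict Implicit. Unset Printing Implicit Defensive.
Import Order.TTheory GRing.Theory Num.Theory.
Local Open Scope ring_scope.
Local Open Scope classical_set_scope.

Section Game.
Variables (R : realType) (K A : nat).

(* A power profile p : p k a = p_{k alpha}; channel gains G k a = g_{k alpha}. *)

Definition in_Delta_k (Pk : R) (r : 'I_A -> R) : Prop :=
  (forall a, 0 <= r a) /\ \sum_(a < A) r a = Pk.

Definition in_Delta (Pmax : 'I_K -> R) (p : 'M[R]_(K, A)) : Prop :=
  forall k, in_Delta_k (Pmax k) (fun a => p k a).

Definition deviate (q : 'M[R]_(K, A)) (k : 'I_K) (r : 'I_A -> R) : 'M[R]_(K, A) :=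
  \matrix_(l, a) (if l == k then r a else q l a).

Definition payoff (b sigma2 : 'I_A -> R) (G : 'M[R]_(K, A)) (k : 'I_K)
    (p : 'M[R]_(K, A)) : R :=
  \sum_(a < A) b a * ln (1 + G k a * p k a /
        (sigma2 a + \sum_(l < K | l != k) G l a * p l a)).

Definition is_NE (Pmax : 'I_K -> R) (b sigma2 : 'I_A -> R) (G : 'M[R]_(K, A))
    (q : 'M[R]_(K, A)) : Prop :=
  in_Delta Pmax q /\
  forall k (r : 'I_A -> R), in_Delta_k (Pmax k) r ->
    payoff b sigma2 G k (deviate q k r) <= payoff b sigma2 G k q.

Definition unique_NE (Pmax : 'I_K -> R) (b sigma2 : 'I_A -> R)
    (G : 'M[R]_(K, A)) : Prop :=
  exists q, is_NE Pmax b sigma2 G q /\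
    forall q', is_NE Pmax b sigma2 G q' -> q' = q.

End Game.

Definition mutually_independent d (T : measurableType d) (R : realType)
    (P : probability T R) (K A : nat) (g : 'I_K -> 'I_A -> T -> R) : Prop :=
  forall B : 'I_K -> 'I_A -> set R, (forall k a, measurable (B k a)) ->
    P [set w | forall k a, B k a (g k a w)] =
    (\big[*%E/1%E]_(k < K) \big[*%E/1%E]_(a < A) P (g k a @^-1` B k a))%E.

(* Main.v *)
Require Import Defs.
From HB Require Import structures.
From mathcomp Require Import all_boot all_order all_algebra.
From mathcomp Require Import all_classical all_reals all_analysis.
From mathcomp Require Import measurable_realfun ring lra.
Import Order.TTheory GRing.Theory Num.Theory.
Import numFieldNormedType.Exports.
Local Open Scope ring_scope.
Local Open Scope classical_set_scope.

(* The game has the concave potential [sum_a b_a ln (s_a + sum_k g_ka p_ka)],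
   whose maximizers over the compact set Delta are equilibria. The first-order
   conditions force any two equilibria to induce the same total load at each
   node; writing c_a for the resulting marginal value, [c_a g_ka] takes a
   constant value [lam_k] wherever one of the two equilibria gives power to
   (k, a). The difference [D] of two distinct equilibria thus yields a nonzero
   matrix [h_ka = lam_k D_ka] with zero row and column sums, and on its support
   [ln g_ka] has the form [x_k + y_a]; hence [sum_ka h_ka ln g_ka = 0]. The
   latter identity may be tested with one fixed [h] per support, so that only
   finitely many linear relations between the [ln g_ka] have to be excluded,
   and each has probability 0 since the gains are independent and nonatomic. *)

(** * Loads, interference and the exact potential *)

Section PotentialGame.
Context {R : realType} {K A : nat}.
Context (Pmax : 'I_K -> R) (b sigma2 : 'I_A -> R) (G : 'M[R]_(K, A)).
Context (hP : forall k, 0 < Pmax k) (hb : forall a, 0 < b a).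
Context (hs : forall a, 0 < sigma2 a) (hG : forall k a, 0 < G k a).
Implicit Types p q : 'M[R]_(K, A).

Definition load p a : R := sigma2 a + \sum_k G k a * p k a.

Definition interference k p a : R := sigma2 a + \sum_(l | l != k) G l a * p l a.

Definition potential p : R := \sum_a b a * ln (load p a).

Lemma load_interference k p a :
  load p a = interference k p a + G k a * p k a.
Proof.
by rewrite /load /interference (bigD1 k)//= [G k a * _ + _]addrC addrA.
Qed.

Lemma interference_gt0 k p a : in_Delta Pmax p -> 0 < interference k p a.
Proof.
move=> pD; apply: ltr_wpDr => //; apply: sumr_ge0 => l _.
by apply: mulr_ge0; [exact: ltW | case: (pD l)].
Qed.

Lemma load_ge p a : in_Delta Pmax p -> sigma2 a <= load p a.
Proof.
move=> pD; rewrite lerDl; apply: sumr_ge0 => l _.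
by apply: mulr_ge0; [exact: ltW | case: (pD l)].
Qed.

Lemma load_gt0 p a : in_Delta Pmax p -> 0 < load p a.
Proof. by move=> pD; apply: lt_le_trans (load_ge _ _ pD). Qed.

(** Each logarithm in the payoff is a difference of log-load and log-interference. The subtracted
    sum involves only the powers of the other users, so a deviation of user [k] changes payoff and
    potential by the same amount. *)
Lemma payoff_potential k p : in_Delta Pmax p ->
  payoff b sigma2 G k p = potential p - \sum_a b a * ln (interference k p a).
Proof.
move=> pD; rewrite -sumrB; apply: eq_bigr => a _; rewrite -mulrBr.
have i0 := interference_gt0 k _ a pD.
rewrite -ln_div ?posrE ?load_gt0//; congr (_ * ln _).
by rewrite (load_interference k) mulrDl divff ?gt_eqF.
Qed.

Lemma in_Delta_deviate q k (r : 'I_A -> R) :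
  in_Delta Pmax q -> in_Delta_k (Pmax k) r -> in_Delta Pmax (deviate q k r).
Proof.
move=> qD rD l; have [->|lk] := eqVneq l k.
  split=> [a|]; first by rewrite mxE eqxx; case: rD.
  by under eq_bigr do rewrite mxE eqxx; case: rD.
split=> [a|]; first by rewrite mxE (negbTE lk); case: (qD l).
by under eq_bigr do rewrite mxE (negbTE lk); case: (qD l).
Qed.

Lemma interference_deviate q k (r : 'I_A -> R) a :
  interference k (deviate q k r) a = interference k q a.
Proof.
by congr (_ + _); apply: eq_bigr => l lk; rewrite mxE (negbTE lk).
Qed.

Lemma load_deviate q k (r : 'I_A -> R) a :
  load (deviate q k r) a = load q a + G k a * (r a - q k a).
Proof.
rewrite !(load_interference k) interference_deviate mxE eqxx.
by rewrite mulrBr addrACA subrr addr0 addrC.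
Qed.

Lemma payoff_deviate_le q k (r : 'I_A -> R) :
  in_Delta Pmax q -> in_Delta_k (Pmax k) r ->
  (payoff b sigma2 G k (deviate q k r) <= payoff b sigma2 G k q) =
  (potential (deviate q k r) <= potential q).
Proof.
move=> qD rD; rewrite !payoff_potential//; last exact: in_Delta_deviate.
by under eq_bigr do rewrite interference_deviate; rewrite lerD2r.
Qed.

(** * First-order conditions at an equilibrium *)

Lemma ln_sub_ge (x y : R) : 0 < x -> 0 < y -> (y - x) / y <= ln y - ln x.
Proof.
move=> x0 y0; rewrite -lerN2 opprB -ln_div ?posrE//.
have -> : - ((y - x) / y) = x / y - 1 by field; rewrite gt_eqF.
have := @le_ln1Dx R (x / y - 1).
by rewrite addrCA subrr addr0; apply; rewrite ltrBrDl subrr divr_gt0.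
Qed.

(** The derivative of [potential] in the load at [a]; thus [price p a * G k a] is its partial
    derivative in the power [p k a]. *)
Definition price p a : R := b a / load p a.

Lemma price_gt0 p a : in_Delta Pmax p -> 0 < price p a.
Proof. by move=> pD; rewrite divr_gt0// load_gt0. Qed.

(** The sum is the directional derivative of [potential] at [q] as row [k] moves towards [r]. A
    quadratic lower bound on the gain replaces differentiation. *)
Lemma NE_variational q k (r : 'I_A -> R) :
  is_NE Pmax b sigma2 G q -> in_Delta_k (Pmax k) r ->
  \sum_a price q a * G k a * (r a - q k a) <= 0.
Proof.
move=> [qD qNE] rD; set L := \sum_a _.
pose del a := G k a * (r a - q k a).
(* The second-order loss has the load after the move in its denominator; its lower bound [sigma2 a]
   stands in for it, which makes [M] independent of the step length. *)
pose M := \sum_a b a * del a ^+ 2 / (load q a * sigma2 a).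
have M0 : 0 <= M.
  apply: sumr_ge0 => a _; rewrite divr_ge0//.
    by rewrite mulr_ge0 ?sqr_ge0// ltW.
  by rewrite mulr_ge0// ltW// load_gt0.
(* Moving a fraction [t] of the way from [q k] to [r] gains at least
   [t L - t^2 M] in potential. *)
have first_order t : 0 < t -> t <= 1 -> L <= t * M.
  move=> t0 t1; pose rt a := q k a + t * (r a - q k a).
  have rtD : in_Delta_k (Pmax k) rt.
    split=> [a|].
      have -> : rt a = (1 - t) * q k a + t * r a by rewrite /rt; ring.
      apply: addr_ge0; apply: mulr_ge0; rewrite ?subr_ge0//.
      - by case: (qD k).
      - exact: ltW.
      - by case: rD.
    rewrite big_split/= -mulr_sumr sumrB (qD k).2 rD.2.
    by rewrite subrr mulr0 addr0.
  have := qNE k rt rtD; rewrite payoff_deviate_le// -subr_le0 -sumrB => qrt.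
  suff : t * L - t * (t * M) <= 0 by rewrite -mulrBr pmulr_rle0// subr_le0.
  apply: le_trans qrt; rewrite !mulr_sumr -sumrB; apply: ler_sum => a _.
  rewrite -[X in _ <= X]mulrBr; have s0 := load_gt0 _ a qD.
  have devD := in_Delta_deviate _ _ _ qD rtD.
  have s'0 := load_gt0 _ a devD.
  apply: (@le_trans _ _ (b a * ((load (deviate q k rt) a - load q a)
     / load (deviate q k rt) a))); last by rewrite ler_pM2l// ln_sub_ge.
  have sE : load (deviate q k rt) a = load q a + t * del a.
    by rewrite load_deviate /rt /del; congr (_ + _); ring.
  have s'ge := load_ge _ a devD.
  rewrite sE in s'0 s'ge *; rewrite -/(del a).
  have -> : t * (price q a * G k a * (r a - q k a))
      - t * (t * (b a * del a ^+ 2 / (load q a * sigma2 a))) =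
      b a * (t * del a / load q a
             - (t * del a) ^+ 2 / load q a * (sigma2 a)^-1).
    rewrite /price /del; field; by rewrite !gt_eqF.
  rewrite ler_pM2l//.
  have -> : (load q a + t * del a - load q a) / (load q a + t * del a) =
      t * del a / load q a
      - (t * del a) ^+ 2 / load q a * (load q a + t * del a)^-1.
    by field; rewrite !gt_eqF.
  rewrite lerD2l lerN2 ler_wpM2l//; first by rewrite divr_ge0 ?sqr_ge0// ltW.
  by rewrite lef_pV2 ?posrE.
rewrite leNgt; apply/negP => L0.
(* The step [t = L / (L + M + 1)] lies in (0, 1] and satisfies [t * M < L], contradicting
   [first_order]. *)
have D0 : 0 < L + M + 1 by lra.
have := first_order (L / (L + M + 1)).
rewrite divr_gt0// ler_pdivrMr// mul1r => /(_ isT) H.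
have {H}: L <= L / (L + M + 1) * M by apply: H; lra.
rewrite mulrAC ler_pdivlMr// ler_pM2l//; lra.
Qed.

(** Each equilibrium is tested against the other and the two inequalities are added. As the price
    decreases with the load, every node contributes a nonnegative multiple of the squared load
    difference, so all these terms vanish. *)
Lemma NE_load_unique q q' a : is_NE Pmax b sigma2 G q ->
  is_NE Pmax b sigma2 G q' -> load q a = load q' a.
Proof.
move=> qNE q'NE.
have var p p' : is_NE Pmax b sigma2 G p -> in_Delta Pmax p' ->
    \sum_a price p a * (load p' a - load p a) <= 0.
  move=> pNE p'D.
  have -> : \sum_a price p a * (load p' a - load p a) =
      \sum_k \sum_a price p a * G k a * (p' k a - p k a).
    rewrite exchange_big/=; apply: eq_bigr => c _.
    rewrite /load opprD addrACA subrr add0r -sumrB mulr_sumr.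
    by apply: eq_bigr => k _; ring.
  by apply: sumr_le0 => k _; apply: NE_variational.
have [qD _] := qNE; have [q'D _] := q'NE.
have s0 := fun c => load_gt0 _ c qD; have s'0 := fun c => load_gt0 _ c q'D.
have := lerD (var _ _ qNE q'D) (var _ _ q'NE qD).
rewrite addr0 -big_split/=.
have termE c : price q c * (load q' c - load q c)
    + price q' c * (load q c - load q' c) =
    b c * (load q c - load q' c) ^+ 2 / (load q c * load q' c).
  by rewrite /price; field; rewrite !gt_eqF.
under eq_bigr do rewrite termE.
have term0 c : 0 <= b c * (load q c - load q' c) ^+ 2 / (load q c * load q' c).
  by rewrite divr_ge0// mulr_ge0 ?sqr_ge0// ltW.
move=> sum_le0.
have /eqP :
    \sum_c b c * (load q c - load q' c) ^+ 2 / (load q c * load q' c) = 0.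
  by apply: le_anti; rewrite sum_le0 sumr_ge0.
rewrite psumr_eq0// => /allP /(_ a (mem_index_enum _)) /eqP/eqP.
rewrite !(mulf_eq0, invr_eq0, sqrf_eq0, subr_eq0).
rewrite (gt_eqF (hb a)) (gt_eqF (s0 a)) (gt_eqF (s'0 a))/= !orbF orbb.
by move=> /eqP.
Qed.

(** Shifting all of [q k a] from [a] to [a'] is an admissible deviation, and its first-order gain is
    [q k a] times the difference of the two marginal values. *)
Lemma NE_slackness q k a a' : is_NE Pmax b sigma2 G q -> 0 < q k a ->
  price q a' * G k a' <= price q a * G k a.
Proof.
move=> qNE qka; have [-> //|aa'] := eqVneq a' a.
have [qD _] := qNE.
pose r c := q k c + q k a * ((c == a')%:R - (c == a)%:R).
have sum_delta c0 (F : 'I_A -> R) : \sum_c F c * (c == c0)%:R = F c0.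
  rewrite (bigD1 c0)//= eqxx mulr1 big1 ?addr0// => c /negbTE->.
  by rewrite mulr0.
have rD : in_Delta_k (Pmax k) r.
  split=> [c|].
    rewrite /r; have [->|ca] := eqVneq c a.
      by rewrite eq_sym (negbTE aa') sub0r mulrN1 subrr.
    by rewrite subr0 addr_ge0 ?mulr_ge0 ?(ltW qka)//; case: (qD k).
  rewrite big_split/=; under [X in _ + X]eq_bigr do rewrite mulrBr.
  by rewrite sumrB !(sum_delta _ (fun=> q k a)) subrr addr0; case: (qD k).
have := NE_variational _ _ _ qNE rD.
under eq_bigr => c _.
  have -> : price q c * G k c * (r c - q k c) =
      q k a * ((price q c * G k c) * (c == a')%:R
               - (price q c * G k c) * (c == a)%:R).
    by rewrite /r; ring.
  over.
rewrite -mulr_sumr pmulr_rle0// sumrB !sum_delta subr_le0//.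
Qed.

(** * A balanced matrix from two distinct equilibria *)

Definition balanced (h : 'M[R]_(K, A)) : Prop :=
  (forall k, \sum_a h k a = 0) /\ (forall a, \sum_k h k a = 0).

Lemma NE_neq_balanced q q' : is_NE Pmax b sigma2 G q ->
  is_NE Pmax b sigma2 G q' -> q' != q ->
  exists h, [/\ h != 0, balanced h & exists x y,
    forall k a, h k a != 0 -> ln (G k a) = x k + y a].
Proof.
move=> qNE q'NE q'q; have [qD _] := qNE; have [q'D _] := q'NE.
have supp k : {a | 0 < q k a}.
  apply/cid; apply: contrapT => /forallNP q0.
  have /eqP := (qD k).2; rewrite big1 ?(lt_eqF (hP k))// => a _.
  by apply/eqP; rewrite eq_le (qD k).1 andbT leNgt; apply/negP/q0.
pose lam k := price q (sval (supp k)) * G k (sval (supp k)).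
have lam0 k : 0 < lam k by rewrite mulr_gt0// price_gt0.
have priceE a : price q' a = price q a.
  by rewrite /price (NE_load_unique _ _ a q'NE qNE).
have lamE k a : q' k a - q k a != 0 -> price q a * G k a = lam k.
  move=> d0; apply: le_anti.
  rewrite (NE_slackness q k _ a qNE (svalP (supp k)))/=.
  have [q0|q0] := ltP 0 (q k a); first by rewrite NE_slackness.
  (* Here [q k a = 0], so [q' k a] must be positive, and slackness is applied to [q'], which has the
     same prices. *)
  rewrite /lam -!priceE NE_slackness// lt0r (q'D k).1 andbT.
  apply: contra_neq d0 => ->; apply/eqP.
  by rewrite sub0r oppr_eq0 eq_le q0 (qD k).1.
pose h : 'M[R]_(K, A) := \matrix_(k, a) (lam k * (q' k a - q k a)).
exists h; split.
- apply: contra_neq q'q => h0; apply/matrixP => k a.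
  move/matrixP/(_ k a): h0; rewrite !mxE => /eqP.
  by rewrite mulf_eq0 gt_eqF//= subr_eq0 => /eqP.
- split=> [k|a]; under eq_bigr do rewrite mxE.
    by rewrite -mulr_sumr sumrB (qD k).2 (q'D k).2 subrr mulr0.
  (* Where the difference is nonzero, [lam k] equals [price q a * G k a]; the column sum is then the
     price times a difference of equal loads. *)
  transitivity (\sum_k price q a * (G k a * q' k a - G k a * q k a)).
    apply: eq_bigr => k _; rewrite -mulrBr mulrA.
    by have [->|/lamE->//] := eqVneq (q' k a - q k a) 0; rewrite !mulr0.
  rewrite -mulr_sumr sumrB.
  by have /addrI -> := NE_load_unique _ _ a q'NE qNE; rewrite subrr mulr0.
- exists (fun k => ln (lam k)), (fun a => - ln (price q a)) => k a.
  rewrite mxE mulf_eq0 negb_or => /andP[_ /lamE <-].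
  by rewrite lnM ?posrE ?price_gt0// addrAC subrr add0r.
Qed.

(** * Existence by maximizing the potential *)

Lemma NE_exists : (0 < A)%N -> exists q, is_NE Pmax b sigma2 G q.
Proof.
(* Profiles are flattened to row vectors so that compactness follows from that of a box, by
   [rV_compact]. *)
move=> A0; pose D : set 'rV[R]_(K * A) := [set v | in_Delta Pmax (vec_mx v)].
have coordE (v : 'rV[R]_(K * A)) k a : vec_mx v k a = v ord0 (mxvec_index k a).
  by rewrite mxE.
have coord_cont k a : continuous (fun v : 'rV[R]_(K * A) => vec_mx v k a).
  by move=> v; under eq_fun do rewrite coordE; exact: coord_continuous.
have D0 : D !=set0.
  have [a0] : inhabited 'I_A by split; exact: Ordinal A0.
  exists (mxvec (\matrix_(k, a) (Pmax k * (a == a0)%:R))).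
  rewrite /D/= mxvecK => k; split=> [a|].
    by rewrite mxE mulr_ge0// ltW.
  under eq_bigr do rewrite mxE.
  rewrite (bigD1 a0)//= eqxx mulr1 big1 ?addr0// => a /negbTE->.
  by rewrite mulr0.
have DE : D =
    (\bigcap_(ka in [set: 'I_K * 'I_A]) [set v | 0 <= vec_mx v ka.1 ka.2])
    `&` \bigcap_(k in [set: 'I_K]) [set v | \sum_a vec_mx v k a = Pmax k].
  apply/seteqP; split=> [v vD|v [v0 vP] k].
    by split=> [[k a] _|k _] /=; case: (vD k).
  by split=> [a|]; [exact: (v0 (k, a) I) | exact: vP].
have closedD : closed D.
  rewrite DE; apply: closedI; apply: closed_bigI => i _.
    exact: (preimage_closed (fun v _ => coord_cont i.1 i.2 v) (@closed_ge R 0)).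
  apply: (preimage_closed _ (@closed_eq R (Pmax i))) => v _.
  apply: continuous_big => [|a _]; [exact: add_continuous|exact: coord_cont].
have compactD : compact D.
  apply: subclosed_compact closedD _ _.
    (* The total budget dominates each [Pmax k], so one interval serves all coordinates. *)
    apply: (@rV_compact _ _ (fun=> `[0, \sum_k Pmax k]%classic)) => i.
    exact: segment_compact.
  move=> v vD i /=.
  case/mxvec_indexP: i => k a; rewrite -coordE in_itv/=.
  have [v0 vP] := vD k; rewrite v0/=.
  apply: (@le_trans _ _ (Pmax k)).
    by rewrite -vP (bigD1 a)//= lerDl sumr_ge0.
  by rewrite (bigD1 k)//= lerDl sumr_ge0// => l _; exact: ltW.
have load_cont a : continuous (fun v : 'rV[R]_(K * A) => load (vec_mx v) a).
  have sum_cont : continuous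
      (fun v : 'rV[R]_(K * A) => \sum_k G k a * vec_mx v k a).
    apply: continuous_big => [|k _ v]; first exact: add_continuous.
    exact: (cvgM (cvg_cst _) (coord_cont k a v)).
  by move=> v; exact: (cvgD (cvg_cst _) (sum_cont v)).
have contD : {within D, continuous (fun v => potential (vec_mx v))}.
  apply: continuous_in_subspaceT => v /set_mem vD.
  have term_cont a :
      {for v, continuous (fun w => b a * ln (load (vec_mx w) a))}.
    have ln_cont : {for v, continuous (fun w => ln (load (vec_mx w) a))}.
      apply: (@continuous_comp _ _ _ (fun w => load (vec_mx w) a) (@ln R)).
        exact: load_cont.
      exact/continuous_ln/load_gt0.
    exact: (cvgM (cvg_cst _) ln_cont).
  exact: (@cvg_big _ _ +%R 0 xpredT add_continuous _ (nbhs v) _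
    (fun a w => b a * ln (load (vec_mx w) a)) _ (nbhs_filter v)
    (fun a _ => term_cont a)).
have [c /set_mem cD cmax] := compact_EVT_max D0 compactD contD.
exists (vec_mx c); split=> // k r rD; rewrite payoff_deviate_le//.
rewrite -[X in potential X <= _]mxvecK; apply: cmax; apply/mem_set.
by rewrite /D/= mxvecK; exact: in_Delta_deviate.
Qed.

End PotentialGame.

(** * Null events for independent nonatomic gains *)

Section Independence.
Context {d : measure_display} {T : measurableType d} {R : realType}.
Context (P : probability T R).

(** By independence the joint law is the product law. The diagonal has singleton sections, which the
    law of [X] does not charge, so Fubini gives it measure zero. *)
Lemma independent_graph_null (X Y : T -> R) :
  measurable_fun setT X -> measurable_fun setT Y ->
  (forall x, P (X @^-1` [set x]) = 0%E) ->
  (forall B C, measurable B -> measurable C ->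
    P (X @^-1` B `&` Y @^-1` C) = (P (X @^-1` B) * P (Y @^-1` C))%E) ->
  {ae P, forall w, X w <> Y w}.
Proof.
move=> mX mY X0 XY.
pose X' : {mfun T >-> R} := HB.pack X (isMeasurableFun.Build _ _ _ _ X mX).
pose Y' : {mfun T >-> R} := HB.pack Y (isMeasurableFun.Build _ _ _ _ Y mY).
(* [Y] comes first because the product measure integrates the second law over sections at a fixed
   first coordinate. *)
pose YX w := (Y w, X w).
have mYX : measurable_fun setT YX by exact: measurable_fun_pair.
pose YX' : {mfun T >-> _} := HB.pack YX (isMeasurableFun.Build _ _ _ _ YX mYX).
pose diag : set (R * R) := [set yx | yx.1 = yx.2].
have mdiag : measurable diag.
  have -> : diag = (fun yx : R * R => yx.1 - yx.2) @^-1` [set 0].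
    apply/seteqP; split=> -[y x]; rewrite /diag/=.
      by move=> ->; rewrite subrr.
    by move/eqP; rewrite subr_eq0 => /eqP.
  by rewrite -[X in measurable X]setTI; exact: measurable_funB.
have prodE :
    (distribution P Y' \x distribution P X')%E diag = distribution P YX' diag.
  apply: product_measure_unique => // B C mB mC.
  by rewrite muleC /distribution /pushforward/= -XY// setIC.
exists (YX @^-1` diag); split; last 1 first.
- by move=> w /= /contrapT /esym.
- by rewrite -[X in measurable X]setTI; exact: (measurable_fun_pair mY mX).
transitivity (distribution P YX' diag) => //; rewrite -prodE.
apply: integral0_eq => y _ /=.
have -> : xsection diag y = [set y].
  apply/seteqP; split=> x; rewrite /xsection/= ?inE/diag/=; first by move=> ->.
  by move=> ->.
exact: X0.
Qed.

Context {K A : nat} (g : 'I_K -> 'I_A -> T -> R).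
Context (gmeas : forall k a, measurable_fun setT (g k a)).
Context (gindep : mutually_independent P g).

(** A pi-system generating the sigma-algebra of all gains except [g k0 a0], whose slot is left
    free. *)
Definition cylinders (k0 : 'I_K) (a0 : 'I_A) : set_system T :=
  [set C | exists B : 'I_K -> 'I_A -> set R, [/\ forall k a, measurable (B k a),
     B k0 a0 = setT & C = [set w | forall k a, B k a (g k a w)]]].

Lemma measurable_cylinder (B : 'I_K -> 'I_A -> set R) :
  (forall k a, measurable (B k a)) ->
  measurable [set w | forall k a, B k a (g k a w)].
Proof.
move=> mB; rewrite [X in measurable X](_ : _ =
    \bigcap_(ka in [set: 'I_K * 'I_A]) (g ka.1 ka.2 @^-1` B ka.1 ka.2));
    last first.
  apply/seteqP; split=> w /= gB => [[k a] _|k a]; first exact: gB.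
  exact: (gB (k, a)).
apply: fin_bigcap_measurable => // ka _.
by rewrite -[X in measurable X]setTI; exact: gmeas.
Qed.

(** Both sides are finite measures in [C]. They agree on the pi-system of cylinders, hence on the
    sigma-algebra it generates. *)
Lemma cylinders_independent k0 a0 (B0 : set R) C : measurable B0 ->
  <<s cylinders k0 a0 >> C ->
  P (g k0 a0 @^-1` B0 `&` C) = (P (g k0 a0 @^-1` B0) * P C)%E.
Proof.
move=> mB0 sC.
have mX : measurable (g k0 a0 @^-1` B0).
  by rewrite -[X in measurable X]setTI; exact: gmeas.
have PXfin : P (g k0 a0 @^-1` B0) \is a fin_num by exact: fin_num_measure.
have PX0 : 0 <= fine (P (g k0 a0 @^-1` B0)) by rewrite fine_ge0.
pose m1 : {measure set T -> \bar R} := mrestr P mX.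
pose m2 : {measure set T -> \bar R} := mscale (NngNum PX0) P.
suff : m1 C = m2 C.
  by rewrite /m1 /m2/= /mrestr /mscale/= fineK// setIC.
move: C sC.
apply: (g_sigma_algebra_measure_unique (cylinders k0 a0) _ (fun=> setT)).
- by move=> _ [B [mB _ ->]]; exact: measurable_cylinder.
- move=> _; exists (fun _ _ => setT); split=> //.
  by apply/seteqP; split.
- by rewrite bigcup_const.
- move=> _ _ [B [mB B0T ->]] [C [mC C0T ->]].
  exists (fun k a => B k a `&` C k a); split=> [k a||].
  + exact: measurableI.
  + by rewrite B0T C0T setIT.
  + apply/seteqP; split=> w /= => [[? ?] k a //|BC].
    by split=> k a; case: (BC k a).
- move=> _ [B [mB BT ->]]; rewrite /m1 /m2/= /mrestr /mscale/= fineK//.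
  (* Putting [B0] into the free slot turns the intersection into one product event, to which
     [gindep] applies. *)
  pose B' k a := if (k, a) == (k0, a0) then B0 else B k a.
  have -> : [set w | forall k a, B k a (g k a w)] `&` g k0 a0 @^-1` B0 =
      [set w | forall k a, B' k a (g k a w)].
    apply/seteqP; split=> w /= => [[gB gB0] k a|gB'].
      by rewrite /B'; case: eqP => // -[-> ->].
    split=> [k a|].
      have := gB' k a; rewrite /B'; case: eqP => // -[-> ->].
      by rewrite BT.
    by have := gB' k0 a0; rewrite /B' eqxx.
  rewrite !gindep//; last first.
    by move=> k a; rewrite /B'; case: ifP.
  rewrite !pair_big/= (bigD1 (k0, a0))//= [in RHS](bigD1 (k0, a0))//=.
  rewrite BT preimage_setT probability_setT mul1e /B' eqxx; congr (_ * _)%E.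
  by apply: eq_bigr => -[k a]/= /negbTE->.
- by move=> _; rewrite /m1/= /mrestr setTI -ge0_fin_numE.
Qed.

(** The space [T] with the coarser sigma-algebra, so that depending only on the other gains becomes
    ordinary measurability. *)
Definition others_type k0 a0 := g_sigma_algebraType (cylinders k0 a0).

Lemma measurable_others k0 a0 k a : (k, a) != (k0, a0) ->
  measurable_fun setT (g k a : others_type k0 a0 -> R).
Proof.
move=> ka _ B mB; rewrite setTI; apply: sub_sigma_algebra.
exists (fun l c => if (l, c) == (k, a) then B else setT); split.
- by move=> l c; case: ifP.
- by rewrite eq_sym (negbTE ka).
- apply/seteqP; split=> w /= => [gB l c|/(_ k a)]; last by rewrite eqxx.
  by case: eqP => // -[-> ->].
Qed.

(** At an entry with nonzero coefficient the relation can be solved for that gain, equating it to a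
    function [Y] of the other gains; [Y] is independent of it, so [independent_graph_null]
    applies. *)
Lemma log_linear_null (h : 'M[R]_(K, A)) : h != 0 ->
  (forall k a, {ae P, forall w, 0 < g k a w}) ->
  (forall k a (x : R), P (g k a @^-1` [set x]) = 0%E) ->
  {ae P, forall w, \sum_k \sum_a h k a * ln (g k a w) != 0}.
Proof.
move=> h0 gpos gnonatomic.
have [k0 [a0 h00]] : exists k a, h k a != 0.
  apply: contrapT => H; case/negP: h0; apply/eqP/matrixP => k a; rewrite mxE.
  by apply: contrapT => /eqP ?; apply: H; exists k, a.
pose rest w := \sum_(ka | ka != (k0, a0)) h ka.1 ka.2 * ln (g ka.1 ka.2 w).
pose Y w := expR (- (h k0 a0)^-1 * rest w).
have mY : measurable_fun setT (Y : others_type k0 a0 -> R).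
  apply: measurableT_comp; first exact: measurable_expR.
  apply: measurable_funM => //.
  rewrite /rest; under eq_fun do rewrite big_mkcond/=.
  apply: measurable_sum => ka; case: eqP => //= /eqP neq.
  apply: measurable_funM => //.
  apply: measurableT_comp; first exact: measurable_ln.
  by apply: measurable_others; case: ka neq.
have sub : <<s cylinders k0 a0 >> `<=` measurable.
  apply: smallest_sub; first exact: sigma_algebra_measurable.
  by move=> _ [B [mB _ ->]]; exact: measurable_cylinder.
have mYT : measurable_fun setT (Y : T -> R).
  by move=> _ B mB; apply: sub; exact: mY.
have aeY : {ae P, forall w, g k0 a0 w <> Y w}.
  apply: independent_graph_null => // B C mB mC.
  apply: cylinders_independent => //.
  by rewrite -[X in <<s _ >> X]setTI; exact: mY.
move: (gpos k0 a0) aeY; apply: filterS2 => w g0; apply: contra_not_neq.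
rewrite pair_big/= (bigD1 (k0, a0))//= -/(rest w) => /eqP.
rewrite addr_eq0 => /eqP hE.
rewrite /Y -[rest w]opprK -hE mulrNN mulrA mulVf// mul1r.
by rewrite lnK.
Qed.

End Independence.

(** * Almost sure uniqueness *)

Lemma balanced_additive (R : realType) (K A : nat) (h : 'M[R]_(K, A)) x y :
  balanced h -> \sum_k \sum_a h k a * (x k + y a) = 0.
Proof.
move=> [hr hc].
transitivity (\sum_k \sum_a h k a * x k + \sum_k \sum_a h k a * y a).
  rewrite -big_split/=; apply: eq_bigr => k _; rewrite -big_split/=.
  by apply: eq_bigr => a _; rewrite mulrDr.
rewrite [X in _ + X]exchange_big/= !big1 ?addr0// => i _.
  by rewrite -mulr_suml hc mul0r.
by rewrite -mulr_suml hr mul0r.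
Qed.

Theorem theorem1 (d : measure_display) (T : measurableType d) (R : realType)
    (P : probability T R) (K A : nat) (hK : (0 < K)%N) (hA : (0 < A)%N)
    (Pmax : 'I_K -> R) (b sigma2 : 'I_A -> R)
    (hP : forall k, 0 < Pmax k) (hb : forall a, 0 < b a)
    (hs : forall a, 0 < sigma2 a)
    (g : 'I_K -> 'I_A -> T -> R)
    (gmeas : forall k a, measurable_fun setT (g k a))
    (gpos : forall k a, {ae P, forall w, 0 < g k a w})
    (gnonatomic : forall k a (x : R), P (g k a @^-1` [set x]) = 0%E)
    (gindep : mutually_independent P g) :
  {ae P, forall w, unique_NE Pmax b sigma2 (\matrix_(k, a) g k a w)}.
Proof.
pose hsupp (h : 'M[R]_(K, A)) := [set ka : 'I_K * 'I_A | h ka.1 ka.2 != 0]%SET.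
(* The matrix obtained from two equilibria depends on [w], but its support [E] ranges over a finite
   type, so the almost sure statements for all [E] hold jointly. *)
have no_additive_support (E : {set 'I_K * 'I_A}) : {ae P, forall w,
    (exists h : 'M[R]_(K, A), [/\ h != 0, balanced h & hsupp h = E]) ->
    ~ exists x y, forall k a, (k, a) \in E -> ln (g k a w) = x k + y a}.
  have [[h [h0 hbal hE]]|noh] :=
      pselect (exists h : 'M[R]_(K, A), [/\ h != 0, balanced h & hsupp h = E]);
    last first.
    by apply: aeW => w /noh.
  have := log_linear_null P g gmeas gindep h h0 gpos gnonatomic.
  apply: filterS => w /eqP ne0 _ [x [y xy]]; apply: ne0.
  rewrite -[RHS](balanced_additive _ _ _ h x y hbal).
  apply: eq_bigr => k _; apply: eq_bigr => a _.
  have [->|hka] := eqVneq (h k a) 0; first by rewrite !mul0r.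
  by rewrite xy// -hE inE.
have ae_pos : {ae P, forall w, forall k a, 0 < g k a w}.
  by apply: filter_forall => k; apply: filter_forall => a; exact: gpos.
apply: filterS2 ae_pos (filter_forall _ no_additive_support) => w gw_pos
  generic.
have hG k a : 0 < (\matrix_(k, a) g k a w) k a by rewrite mxE.
have [q qNE] := NE_exists Pmax b sigma2 _ hP hs hG hA.
exists q; split=> // q' q'NE; apply/eqP; apply: contraT => q'q.
have [h [h0 hbal [x [y xy]]]] :=
  NE_neq_balanced Pmax b sigma2 _ hP hb hs hG q q' qNE q'NE q'q.
case: (generic (hsupp h)); first by exists h.
by exists x, y => k a; rewrite inE/= => /xy; rewrite mxE.
Qed.
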